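(* For every integer $n\ge 1$, $$|\mathcal D_5(n)|=|\mathcal C_{1,2}(n)|+|\mathcal C_{3,4}(n-1)|.$$
   Context: A partition of $n$ is a non-increasing sequence of positive integers (parts) with sum $n$, denoted $|\lambda|=n$ for the partition $\lambda$; the empty partition is the only partition of $0$. $\mathcal D_5(n)$ denotes the set of distinct $5$-regular partitions of $n$, i.e. partitions of $n$ into distinct parts none of which is divisible by $5$. For integers $a,b$ with $0<a,b<10$ and $a\not\equiv\pm b\pmod{10}$, $\mathcal C_{a,b}(n)$ denotes the set of pairs of partitions $(\lambda,\mu)$ with $|\lambda|+|\mu|=n$ such that $\lambda$ is a partition with distinct parts, none of which is congruent to $\pm a$ or $\pm b$ modulo $10$, and $\mu$ is a partition with distinct parts, all divisible by $5$. (Either of $\lambda,\mu$ may be empty.) *)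

(* Defs.v *)
From mathcomp Require Import all_boot.

Set Implicit Arguments.
Unset Strict Implicit.
Unset Printing Implicit Defensive.

Definition is_partition (l : seq nat) : bool := sorted geq l && all (leq 1) l.

(* A finite type through which partitions of numbers at most [n] are counted:
   lists of length at most [n] with entries at most [n].  By [in_boxP] below
   the two bounds exclude no such partition. *)
Definition box (n : nat) : finType := n.-bseq 'I_n.+1.

Definition parts (n : nat) (s : box n) : seq nat :=
  [seq val i | i <- (s : n.-bseq 'I_n.+1)].

Lemma parts_inj (n : nat) : injective (@parts n).
Proof. by move=> s t /(inj_map val_inj) /val_inj. Qed.

Lemma in_boxP (n : nat) (l : seq nat) :
  is_partition l -> sumn l <= n -> exists s : box n, parts s = l.
Proof.
case/andP=> _ pos_l sum_l.
have size_l : size l <= n.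
  apply: leq_trans sum_l; elim: l pos_l => //= x l IHl /andP[x_gt0 /IHl le_l].
  by rewrite -add1n leq_add.
have le_l x : x \in l -> x < n.+1.
  move=> lx; rewrite ltnS; apply: leq_trans sum_l.
  by rewrite (perm_sumn (perm_to_rem lx)) /= leq_addr.
have size_i : size [seq inord x : 'I_n.+1 | x <- l] <= n by rewrite size_map.
exists (Bseq size_i); rewrite /parts /= -map_comp -[RHS]map_id.
by apply/eq_in_map => x lx /=; rewrite inordK ?le_l.
Qed.

Definition D5 (n : nat) : {set box n} :=
  [set l | [&& is_partition (parts l), sumn (parts l) == n, uniq (parts l)
             & all (fun x => ~~ (5 %| x)) (parts l)]].

(* [x] is congruent to [a] or [- a]; on [nat] the latter reads [x + a = 0]. *)
Definition congr_pm10 (x a : nat) : bool :=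
  (x == a %[mod 10]) || (x + a == 0 %[mod 10]).

Definition C (a b n : nat) : {set box n * box n} :=
  [set p | [&& is_partition (parts p.1), is_partition (parts p.2),
               sumn (parts p.1) + sumn (parts p.2) == n,
               uniq (parts p.1),
               all (fun x => ~~ congr_pm10 x a && ~~ congr_pm10 x b)
                   (parts p.1),
               uniq (parts p.2)
             & all (fun x => 5 %| x) (parts p.2)]].

(* Main.v *)
Require Import Defs.
From mathcomp Require Import all_boot all_order all_algebra.
From mathcomp Require Import zify ring.

Set Implicit Arguments.
Unset Strict Implicit.
Unset Printing Implicit Defensive.

(** Write [(x; p)] for the product of [1 + q ^ (x + p i)] over [i >= 0] and
    [(x, y; p) = (x; p) (y; p)].  Translated into generating functions, the
    theorem is the product identity

      (1, 4; 5) (2, 3; 5)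
        = (5; 5)^2 ((3, 7; 10) (4, 6; 10) + q (1, 9; 10) (2, 8; 10)),

    where one factor [(5; 5)] comes from the parts divisible by 5 that the
    first partition of a pair may have, and the other from the second
    partition.

    Put [P_k] for the product of [1 - q ^ (k i)] over [i >= 1].  By the Jacobi
    triple product, [P_k (a, k - a; k)] is a theta series, the sum over all
    integers [s] of [q ^ ((k s^2 + (2 a - k) s) / 2)].  Multiplying the
    left-hand side by [P_5 ^ 2] thus gives the double sum of
    [q ^ ((5 m^2 - 3 m + 5 n^2 - n) / 2)].  Splitting it by the parity of
    [m + n], and substituting [m = s + t, n = s - t] in the even part and
    [m = 1 - s - t, n = s - t] in the odd one, makes each part a product of two
    theta series for [k = 10]: this is [theta_product_split].  The triple
    product, read backwards, gives
    [P_10 ^ 2 ((3, 7; 10) (4, 6; 10) + q (1, 9; 10) (2, 8; 10))], and since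
    [P_10 = P_5 (5; 5)] the factor [P_5 ^ 2] cancels ([theta_quotient_split]).

    Formal power series enter only through their truncations: all identities
    are proved in an arbitrary commutative ring with an element [q] such that
    [q ^+ K = 0].  There infinite products and sums are finite ones that are
    long enough, factors [1 - q ^+ n] with [n > 0] can be cancelled, and the
    equalities are exact.  The ring of integer polynomials modulo ['X^K] then gives the
    equality of all coefficients below [K].  The triple product itself is the
    limit of its finite form with q-binomial coefficients,
    [finite_jacobi_triple_product], which holds in every commutative ring. *)

Import Order.TTheory GRing.Theory Num.Theory.
Local Open Scope ring_scope.

(** * Gaussian binomials and the finite triple product *)

Section QBinomial.
Variables (R : comNzRingType) (r : R).

Fixpoint qbin (n k : nat) : R :=
  match n, k with
  | _, 0%N => 1
  | 0%N, _.+1 => 0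
  | n'.+1, k'.+1 => qbin n' k' + r ^+ k * qbin n' k
  end.

Definition qpoch (n : nat) : R := \prod_(i < n) (1 - r ^+ i.+1).

Lemma qbin0 n : qbin n 0 = 1.
Proof. by case: n. Qed.

Lemma qbinS n k : qbin n.+1 k.+1 = qbin n k + r ^+ k.+1 * qbin n k.+1.
Proof. by []. Qed.

Lemma qbin_small n k : (n < k)%N -> qbin n k = 0.
Proof.
elim: n k => [|n IHn] [|k] //= ltnk.
by rewrite !IHn ?mulr0 ?addr0 // ltnW.
Qed.

Lemma qpochS n : qpoch n.+1 = qpoch n * (1 - r ^+ n.+1).
Proof. by rewrite /qpoch big_ord_recr. Qed.

(** The quotient formula for Gaussian binomials, cleared of denominators
    because factors [1 - r ^+ i] need not be invertible. *)
Lemma qbin_qpoch k m : qbin (k + m) k * qpoch k * qpoch m = qpoch (k + m).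
Proof.
move En: (k + m)%N => n; elim: n k m En => [|n IHn] [|k] m //.
- by case: m => // _; rewrite /qpoch !big_ord0 !mulr1.
- by rewrite add0n => ->; rewrite qbin0 /qpoch big_ord0 !mul1r.
rewrite addSn => -[En]; rewrite qbinS qpochS.
case: m => [|m] in En *.
  rewrite addn0 in En; rewrite -En in IHn *.
  rewrite (@qbin_small k k.+1) // mulr0 addr0 [RHS]qpochS.
  by rewrite -{2}(IHn k 0%N (addn0 k)); ring.
have IHk := IHn k _ En; have IHm := IHn k.+1 m; rewrite addSnnS in IHm.
rewrite mulrDl mulrDl.
transitivity ((1 - r ^+ k.+1) * qpoch n
              + r ^+ k.+1 * (1 - r ^+ m.+1) * qpoch n).
  congr (_ + _); first by rewrite -IHk; ring.
  by rewrite -(IHm En) !qpochS; ring.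
rewrite qpochS -En -addSn exprD; ring.
Qed.

(** The Pascal rule applied under a sum, with both parts indexed alike: the
    form in which it drives the inductions below. *)
Lemma sum_qbinS (c : nat -> R) n :
  \sum_(j < n.+2) qbin n.+1 j * c j
  = \sum_(j < n.+1) qbin n j * (r ^+ j * c j + c j.+1).
Proof.
rewrite big_ord_recl qbin0 mul1r.
under eq_bigr => j _ do rewrite lift0 qbinS mulrDl.
rewrite big_split /=.
have -> : \sum_(j < n.+1) r ^+ j.+1 * qbin n j.+1 * c j.+1
          = \sum_(j < n.+1) qbin n j * (r ^+ j * c j) - c 0%N.
  rewrite big_ord_recr /= (@qbin_small n n.+1) // mulr0 mul0r addr0.
  rewrite [X in _ = X - _]big_ord_recl qbin0 /= !mul1r addrAC subrr add0r.
  by apply: eq_bigr => j _; rewrite /bump leq0n add1n; ring.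
under [RHS]eq_bigr => j _ do rewrite mulrDr.
rewrite big_split /=; ring.
Qed.

(** For [z * w = r], this is the Laurent monomial [z ^ s * r ^ (s (s - 1) / 2)];
    using [w] for negative [s] avoids inverting [z] and [r]. *)
Definition theta_term (z w : R) (s : int) : R :=
  match s with
  | Posz m => z ^+ m * r ^+ 'C(m, 2)
  | Negz m => w ^+ m.+1 * r ^+ 'C(m.+1, 2)
  end.

Lemma theta_termN z w m :
  theta_term z w (- m%:Z) = w ^+ m * r ^+ 'C(m, 2).
Proof. by case: m => [|m] //; rewrite /= !expr0. Qed.

(** The functional equation of the theta series, term by term: it accounts for
    a new factor [1 + w * r ^+ N] in the product. *)
Lemma theta_term_step z w N j : z * w = r ->
  w * r ^+ N * theta_term z w (j%:Z - N%:Z)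
  = r ^+ j * theta_term z w (j%:Z - N.+1%:Z).
Proof.
move=> zw; have [ltNj|lejN] := ltnP N j.
  have [m ->] : exists m, j = (N + m.+1)%N by exists (j - N).-1; lia.
  have -> : (N + m.+1)%:Z - N%:Z = m.+1%:Z by lia.
  have -> : (N + m.+1)%:Z - N.+1%:Z = m%:Z by lia.
  rewrite /= binS bin1 !exprD !exprS -zw; ring.
have [m ->] : exists m, N = (j + m)%N by exists (N - j)%N; lia.
have -> : j%:Z - (j + m)%:Z = - m%:Z by lia.
have -> : j%:Z - (j + m).+1%:Z = - m.+1%:Z by lia.
rewrite !theta_termN binS bin1 !exprD !exprS; ring.
Qed.

(** The case without factors [1 + w * r ^+ i], by splitting off the factor
    [1 + z] and replacing [z] by [z * r] in the others. *)
Lemma qbinomial_theorem z M :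
  \prod_(i < M) (1 + z * r ^+ i)
  = \sum_(j < M.+1) qbin M j * (z ^+ j * r ^+ 'C(j, 2)).
Proof.
elim: M z => [|M IHM] z.
  by rewrite big_ord0 big_ord_recl big_ord0 /= !mulr1 addr0.
rewrite big_ord_recl (sum_qbinS (fun j => z ^+ j * r ^+ 'C(j, 2))).
rewrite expr0 mulr1.
under eq_bigr => i _ do rewrite lift0 exprS mulrA.
rewrite IHM mulr_sumr; apply: eq_bigr => j _.
rewrite binS bin1 exprMn exprD exprS; ring.
Qed.

(** Induction on [N]: by [theta_term_step], multiplying by [1 + w * r ^+ N]
    combines neighbouring terms exactly as the Pascal rule requires.  Keeping
    [M] and [N] independent is what lets one factor be added at a time. *)
Lemma finite_jacobi_triple_product z w M N : z * w = r ->
  \prod_(i < M) (1 + z * r ^+ i) * \prod_(i < N) (1 + w * r ^+ i)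
  = \sum_(j < (N + M).+1) qbin (N + M) j * theta_term z w (j%:Z - N%:Z).
Proof.
move=> zw; elim: N => [|N IHN].
  rewrite big_ord0 mulr1 qbinomial_theorem.
  by apply: eq_bigr => j _; rewrite subr0.
rewrite big_ord_recr mulrA IHN /= addSn.
rewrite (sum_qbinS (fun j => theta_term z w (j%:Z - N.+1%:Z))) mulr_suml.
apply: eq_bigr => j _.
have -> : j.+1%:Z - N.+1%:Z = j%:Z - N%:Z by lia.
by rewrite -mulrA -theta_term_step //; ring.
Qed.

End QBinomial.

(** * Theta series and the triple product for a nilpotent q *)

(** The exponent of [q] in the [s]-th theta term for [z = q ^+ a] and
    [w = q ^+ b]: half of [(a + b) s^2 + (a - b) s]. *)
Definition theta_exp (a b : nat) (s : int) : nat :=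
  match s with
  | Posz m => a * m + (a + b) * 'C(m, 2)
  | Negz m => b * m.+1 + (a + b) * 'C(m.+1, 2)
  end.

Lemma double_bin2 m : 'C(m, 2)%:Z * 2 = m%:Z * m%:Z - m%:Z.
Proof. by elim: m => [|m IHm] //; rewrite binS bin1 PoszD; lia. Qed.

Lemma theta_exp_double a b s :
  (theta_exp a b s)%:Z * 2 = (a + b)%:Z * s ^+ 2 + (a%:Z - b%:Z) * s.
Proof.
case: s => m; rewrite /theta_exp.
  by rewrite PoszD !PoszM mulrDl -[X in _ + X]mulrA double_bin2 PoszD; ring.
by rewrite PoszD !PoszM mulrDl -[X in _ + X]mulrA double_bin2 PoszD NegzE; ring.
Qed.

Lemma theta_exp_ge a b s :
  (0 < a)%N -> (0 < b)%N -> (`|s| <= theta_exp a b s)%N.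
Proof.
move=> a_gt0 b_gt0; case: s => m /=.
  by apply: leq_trans (leq_addr _ _); rewrite leq_pmull.
by apply: leq_trans (leq_addr _ _); rewrite leq_pmull.
Qed.

Lemma theta_termX (R : comNzRingType) (q : R) a b s :
  theta_term (q ^+ (a + b)) (q ^+ a) (q ^+ b) s = q ^+ theta_exp a b s.
Proof. by case: s => m; rewrite /= -!exprM -exprD. Qed.

Definition window (N : nat) : seq int :=
  [seq j%:Z - N%:Z | j <- iota 0 (N + N).+1].

Lemma mem_window N s : (s \in window N) = (`|s| <= N)%N.
Proof.
apply/mapP/idP => [[j]|le_s].
  by rewrite mem_iota => /andP[_ ?] ->; lia.
by exists (absz (s + N%:Z)); [rewrite mem_iota; lia | lia].
Qed.

Lemma window_uniq N : uniq (window N).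
Proof. by rewrite map_inj_uniq ?iota_uniq // => i j; lia. Qed.

Section Nilpotent.
Variables (R : comNzRingType) (q : R) (K : nat).
Hypothesis qK : q ^+ K = 0.

Lemma nilX n : (K <= n)%N -> q ^+ n = 0.
Proof. by move=> leKn; rewrite -(subnKC leKn) exprD qK mul0r. Qed.

(** If [x = q ^+ n * x], iterating gives [x = q ^+ (n * K) * x = 0]. *)
Lemma mul_sub1X_eq0 n x : (0 < n)%N -> (1 - q ^+ n) * x = 0 -> x = 0.
Proof.
move=> n_gt0; rewrite mulrBl mul1r => /eqP; rewrite subr_eq0 => /eqP x_eq.
have x_iter i : x = q ^+ (n * i) * x.
  by elim: i => [|i IHi]; rewrite ?muln0 ?mul1r // mulnS exprD -mulrA -IHi.
by rewrite (x_iter K) nilX ?mul0r // leq_pmull.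
Qed.

Lemma qpoch_inj k n : (0 < k)%N -> injective ( *%R (qpoch (q ^+ k) n)).
Proof.
move=> k_gt0 x y /eqP; rewrite -subr_eq0 -mulrBr => /eqP xy.
apply/eqP; rewrite -subr_eq0; apply/eqP; elim: n (x - y) xy => [|n IHn] u.
  by rewrite /qpoch big_ord0 mul1r.
rewrite qpochS -mulrA => /IHn; rewrite -exprM; apply: mul_sub1X_eq0; lia.
Qed.

Lemma qpoch_stable k n : (0 < k)%N -> (K <= n)%N ->
  qpoch (q ^+ k) n = qpoch (q ^+ k) K.
Proof.
move=> k_gt0 leKn; rewrite -(subnKC leKn); elim: (n - K)%N => [|m IHm].
  by rewrite addn0.
rewrite addnS qpochS IHm -exprM (@nilX (k * _)) ?subr0 ?mulr1 //.
by apply: leq_trans (leq_pmull _ k_gt0); lia.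
Qed.

(** In the finite form, the q-binomial coefficient at [s] is inverse to the
    Euler product as soon as [N + s] and [N - s] are at least [K]; in all the
    other terms the power of [q] vanishes because [theta_exp] is at least
    [`|s|].  The bound [K + K <= N] ensures that one of the two happens. *)
Lemma jacobi_triple_product a b N : (0 < a)%N -> (0 < b)%N -> (K + K <= N)%N ->
  qpoch (q ^+ (a + b)) N *
    (\prod_(i < N) (1 + q ^+ (a + (a + b) * i)) *
     \prod_(i < N) (1 + q ^+ (b + (a + b) * i)))
  = \sum_(s <- window N) q ^+ theta_exp a b s.
Proof.
move=> a_gt0 b_gt0 leN.
have k_gt0 : (0 < a + b)%N by lia.
under [X in _ * (X * _)]eq_bigr => i _ do rewrite exprD exprM.
under [X in _ * (_ * X)]eq_bigr => i _ do rewrite exprD exprM.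
rewrite (finite_jacobi_triple_product (r := q ^+ (a + b))) -?exprD // big_map.
rewrite -(big_mkord predT (fun j => qbin (q ^+ (a + b)) (N + N) j *
  theta_term (q ^+ (a + b)) (q ^+ a) (q ^+ b) (j%:Z - N%:Z))).
rewrite /index_iota subn0 mulr_sumr; apply: eq_big_seq => j.
rewrite mem_iota add0n ltnS => /andP[_ lej].
rewrite theta_termX mulrA.
have [small|big] := ltnP (theta_exp a b (j%:Z - N%:Z)) K;
  last by rewrite (nilX big) mulr0.
have := @theta_exp_ge a b (j%:Z - N%:Z) a_gt0 b_gt0 => ge_exp.
rewrite -[RHS]mul1r; congr (_ * _).
apply: (@qpoch_inj (a + b) K) => //; rewrite mulr1.
have := qbin_qpoch (q ^+ (a + b)) j (N + N - j); rewrite subnKC //.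
rewrite !(@qpoch_stable (a + b)) //; try lia.
by move=> qbinE; rewrite -[RHS]qbinE; ring.
Qed.

(** Two sums of powers of [q] over finite windows of infinite index sets agree
    as soon as the index sets correspond bijectively, whatever the windows, if
    these contain all indices whose power of [q] may be nonzero.  The bijection
    is the parametrisation [g] of the indices that satisfy [P]. *)
Lemma sum_expr_reindex (I J : eqType) (s1 : seq I) (s2 : seq J)
    (P : pred I) (e1 : I -> nat) (e2 : J -> nat) (g : J -> I) :
    uniq s1 -> uniq s2 -> injective g ->
    (forall x, P x -> exists y, x = g y) ->
    (forall y, P (g y)) -> (forall y, e1 (g y) = e2 y) ->
    (forall x, (e1 x < K)%N -> x \in s1) ->
    (forall y, (e2 y < K)%N -> y \in s2) ->
  \sum_(x <- s1 | P x) q ^+ e1 x = \sum_(y <- s2) q ^+ e2 y.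
Proof.
move=> uniq1 uniq2 g_inj g_surj Pg e1g mem1 mem2.
rewrite (bigID (fun x => e1 x < K)%N) /= [X in _ + X]big1 ?addr0; last first.
  by move=> x /andP[_]; rewrite -leqNgt; apply: nilX.
rewrite [RHS](bigID (fun y => e2 y < K)%N) /=.
rewrite [X in _ = _ + X]big1 ?addr0; last first.
  by move=> y; rewrite -leqNgt; apply: nilX.
under [RHS]eq_bigr => y _ do rewrite -e1g.
rewrite -big_filter -[RHS]big_filter -(big_map g predT (fun x => q ^+ e1 x)).
apply: perm_big; apply: uniq_perm.
- exact: filter_uniq.
- by rewrite map_inj_uniq // filter_uniq.
move=> x; rewrite mem_filter; apply/idP/mapP => [/andP[/andP[Px small] _]|[y]].
  have [y def_x] := g_surj x Px; exists y => //.
  by rewrite mem_filter -e1g -def_x small mem2 // -e1g -def_x.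
rewrite mem_filter => /andP[small _] ->.
by rewrite Pg e1g small mem1 // e1g.
Qed.

Lemma double_sum a b c d N :
  (\sum_(s <- window N) q ^+ theta_exp a b s) *
  (\sum_(s <- window N) q ^+ theta_exp c d s)
  = \sum_(x <- [seq (s, t) | s <- window N, t <- window N])
       q ^+ (theta_exp a b x.1 + theta_exp c d x.2).
Proof.
rewrite big_allpairs_dep /= mulr_suml; apply: eq_bigr => s _.
by rewrite mulr_sumr; apply: eq_bigr => t _; rewrite exprD.
Qed.

Lemma window2_uniq N : uniq [seq (s, t) | s <- window N, t <- window N].
Proof. by apply: allpairs_uniq; rewrite ?window_uniq // => -[? ?] [? ?]. Qed.

Lemma mem_window2 N a b c d (x : int * int) :
  (0 < a)%N -> (0 < b)%N -> (0 < c)%N -> (0 < d)%N -> (K <= N)%N ->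
  (theta_exp a b x.1 + theta_exp c d x.2 < K)%N ->
  x \in [seq (s, t) | s <- window N, t <- window N].
Proof.
case: x => s t a0 b0 c0 d0 leK small; rewrite /= in small.
apply/allpairsP; exists (s, t).
split=> //=; rewrite mem_window.
  by have := theta_exp_ge s a0 b0; lia.
by have := theta_exp_ge t c0 d0; lia.
Qed.

(** The quadratic form [m^2 + n^2] becomes twice [s^2 + t^2] under
    [m = s + t, n = s - t], a substitution that reaches the pairs with [m + n]
    even; the variant for the odd pairs is chosen so that the linear terms are
    those of the exponents on the right. *)
Lemma theta_product_split N1 N2 : (K <= N1)%N -> (K <= N2)%N ->
  (\sum_(s <- window N1) q ^+ theta_exp 1 4 s) *
  (\sum_(s <- window N1) q ^+ theta_exp 2 3 s)
  = (\sum_(s <- window N2) q ^+ theta_exp 3 7 s) *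
    (\sum_(s <- window N2) q ^+ theta_exp 4 6 s)
  + q * ((\sum_(s <- window N2) q ^+ theta_exp 1 9 s) *
         (\sum_(s <- window N2) q ^+ theta_exp 2 8 s)).
Proof.
move=> leN1 leN2; rewrite !double_sum mulr_sumr.
under [X in _ = _ + X]eq_bigr => x _ do rewrite -exprS.
rewrite (bigID (fun x : int * int => ((x.1 + x.2) %% 2 == 0)%Z)) /=.
congr (_ + _).
  apply: (sum_expr_reindex (g := fun y => (y.1 + y.2, y.1 - y.2)));
    rewrite ?window2_uniq //; try by move=> x; apply: mem_window2.
  - by move=> [s t] [s' t'] [] *; congr (_, _); lia.
  - move=> [m n] /= even_mn; exists ((m + n) %/ 2, (m - n) %/ 2)%Z.
    by congr (_, _) => /=; lia.
  - by move=> [s t] /=; lia.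
  move=> [s t] /=.
  have := theta_exp_double 1 4 (s + t); have := theta_exp_double 2 3 (s - t).
  have := theta_exp_double 3 7 s; have := theta_exp_double 4 6 t.
  have -> : (s + t) ^+ 2 = s ^+ 2 + s * t *+ 2 + t ^+ 2 by ring.
  have -> : (s - t) ^+ 2 = s ^+ 2 - s * t *+ 2 + t ^+ 2 by ring.
  lia.
apply: (sum_expr_reindex (g := fun y => (1 - y.1 - y.2, y.1 - y.2)));
    rewrite ?window2_uniq //; try by move=> x; apply: mem_window2.
- by move=> [s t] [s' t'] [] *; congr (_, _); lia.
- move=> [m n] /= odd_mn; exists ((1 - m + n) %/ 2, (1 - m - n) %/ 2)%Z.
  by congr (_, _) => /=; lia.
- by move=> [s t] /=; lia.
- move=> [s t] /=.
  have := theta_exp_double 1 4 (1 - s - t).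
  have := theta_exp_double 2 3 (s - t).
  have := theta_exp_double 1 9 s; have := theta_exp_double 2 8 t.
  have -> : (1 - s - t) ^+ 2
      = s ^+ 2 + s * t *+ 2 + t ^+ 2 + 1 - s *+ 2 - t *+ 2 by ring.
  have -> : (s - t) ^+ 2 = s ^+ 2 - s * t *+ 2 + t ^+ 2 by ring.
  lia.
move=> x small; apply: (@mem_window2 _ 1 9 2 8) => //; lia.
Qed.

End Nilpotent.

(** * The product identity *)

Definition distinct_gf (R : comNzRingType) (q : R) (A : pred nat) (B : nat) :
    R :=
  \prod_(i < B | A i.+1) (1 + q ^+ i.+1).

Lemma rmorph_distinct_gf (R S : comNzRingType) (f : {rmorphism R -> S}) q A B :
  f (distinct_gf q A B) = distinct_gf (f q) A B.
Proof.
by rewrite rmorph_prod; apply: eq_bigr => i _; rewrite rmorphD rmorph1 rmorphXn.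
Qed.

Definition avoids (a b x : nat) : bool :=
  ~~ congr_pm10 x a && ~~ congr_pm10 x b.

Section Progressions.
Variables (R : comNzRingType) (q : R).

Definition prog (k N a : nat) : R := \prod_(i < N) (1 + q ^+ (a + k * i)).

Lemma prog_double k N a :
  prog k (N + N) a = prog (k + k) N a * prog (k + k) N (a + k).
Proof.
rewrite /prog; elim: N => [|N IHN]; first by rewrite !big_ord0 mulr1.
rewrite addnS addSn !big_ord_recr IHN /=.
have -> : (a + k * (N + N) = a + (k + k) * N)%N by lia.
have -> : (a + k * (N + N).+1 = a + k + (k + k) * N)%N by lia.
ring.
Qed.

Lemma distinct_gf_prog (A : pred nat) k N :
    (forall i j, A (j + k * i)%N = A j) ->
  distinct_gf q A (k * N) = \prod_(j < k | A j.+1) prog k N j.+1.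
Proof.
move=> A_per; rewrite /distinct_gf /prog; elim: N => [|N IHN].
  by rewrite muln0 big_ord0 big1 // => j _; rewrite big_ord0.
under [RHS]eq_bigr => j _ do rewrite big_ord_recr.
rewrite big_split -IHN mulnS addnC big_split_ord /=; congr (_ * _).
apply: eq_big => [j|j _]; first by rewrite -addnS addnC A_per.
by rewrite -addnS addnC.
Qed.

(** This is [(1 - x) * (1 + x) = 1 - x ^+ 2], factor by factor; it turns the
    Euler product modulo 5 into the one modulo 10. *)
Lemma qpoch_double k N :
  qpoch (q ^+ k) N * prog k N k = qpoch (q ^+ (k + k)) N.
Proof.
rewrite /qpoch /prog -big_split; apply: eq_bigr => i _ /=.
by rewrite -!exprM -mulnS mulnDl exprD; ring.
Qed.

(** [theta_product_split] with each theta series written as a product.  All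
    factors are sorted by residue modulo 10: a progression modulo 5 splits into
    two of them, hence its double length [N + N]. *)
Lemma theta_quotient_split K N : q ^+ K = 0 -> (K + K <= N)%N ->
  prog 10 N 1 * prog 10 N 2 * prog 10 N 3 * prog 10 N 4 *
  (prog 10 N 6 * prog 10 N 7 * prog 10 N 8 * prog 10 N 9)
  = (prog 10 N 5 * prog 10 N 10) ^+ 2 *
    (prog 10 N 3 * prog 10 N 4 * prog 10 N 6 * prog 10 N 7
     + q * (prog 10 N 1 * prog 10 N 2 * prog 10 N 8 * prog 10 N 9)).
Proof.
move=> qK leN.
have jtp a b M := @jacobi_triple_product _ q K qK a b M.
have := @theta_product_split _ q K qK (N + N) N.
rewrite -(jtp 1 4) -?(jtp 2 3) -?(jtp 3 7) -?(jtp 4 6) -?(jtp 1 9) -?(jtp 2 8);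
  try lia.
rewrite -!/(prog _ _ _) !prog_double.
have -> : qpoch (q ^+ 10) N = qpoch (q ^+ (5 + 5)) (N + N).
  by rewrite (@qpoch_stable _ q K) // ?[RHS](@qpoch_stable _ q K) //; lia.
rewrite -qpoch_double prog_double => split_eq.
apply: (@qpoch_inj _ q K qK 5 (N + N)) => //.
apply: (@qpoch_inj _ q K qK 5 (N + N)) => //.
transitivity (qpoch (q ^+ 5) (N + N) *
  (prog 10 N 1 * prog 10 N 6 * (prog 10 N 4 * prog 10 N 9)) *
  (qpoch (q ^+ 5) (N + N) *
  (prog 10 N 2 * prog 10 N 7 * (prog 10 N 3 * prog 10 N 8)))); first by ring.
rewrite split_eq; try lia; ring.
Qed.

Lemma prod10 (A : pred nat) (f : nat -> R) :
  let f' j := if A j then f j else 1 in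
  \prod_(j < 10 | A j.+1) f j.+1
  = f' 1%N * f' 2%N * f' 3%N * f' 4%N * f' 5%N *
    f' 6%N * f' 7%N * f' 8%N * f' 9%N * f' 10%N.
Proof. by rewrite /= big_mkcond !big_ord_recl big_ord0 /= mulr1 !mulrA. Qed.

(** With the parts sorted by residue modulo 10, this is [theta_quotient_split]
    with one factor of the square of the product over the multiples of 5
    absorbed by [avoids 1 2] and [avoids 3 4], which allow these parts. *)
Lemma distinct_gf_identity K N : q ^+ K = 0 -> (K + K <= N)%N ->
  distinct_gf q (fun x => ~~ (5 %| x)%N) (10 * N)
  = distinct_gf q (avoids 1 2) (10 * N) * distinct_gf q (dvdn 5) (10 * N)
    + q * (distinct_gf q (avoids 3 4) (10 * N) *
           distinct_gf q (dvdn 5) (10 * N)).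
Proof.
move=> qK leN; rewrite !(@distinct_gf_prog _ 10);
  try by move=> i j; rewrite /avoids /congr_pm10; lia.
rewrite (prod10 (fun x => ~~ (5 %| x)%N)) !(prod10 _ (prog 10 N)).
rewrite /avoids /congr_pm10 /= !mul1r !mulr1.
have := theta_quotient_split qK leN; rewrite !mulrA => ->; ring.
Qed.

End Progressions.

(** * Counting partitions by coefficients *)

Definition distinct_in (A : pred nat) (l : seq nat) : bool :=
  [&& is_partition l, uniq l & all A l].

Definition distinct_boxes (A : pred nat) (n m : nat) : {set box n} :=
  [set s | distinct_in A (parts s) && (sumn (parts s) == m)].

(** The element [i] of ['I_B] stands for the part [i.+1]. *)
Definition weighted_sets (A : pred nat) (B m : nat) : {set {set 'I_B}} :=
  [set S : {set 'I_B} | [forall i in S, A i.+1] &&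
     (\sum_(i in S) i.+1 == m)%N].

(** Expanding the product: choosing a term of each factor is choosing a set of
    parts. *)
Lemma coef_distinct_gf_sets A B m :
  (distinct_gf ('X : {poly int}) A B)`_m = #|weighted_sets A B m|%:R.
Proof.
rewrite /distinct_gf big_mkcond /=.
have -> : \prod_(i < B) (if A i.+1 then 1 + 'X^(i.+1) else 1)
    = \prod_(i < B) ((if A i.+1 then 'X^(i.+1) else 0) + 1) :> {poly int}.
  by apply: eq_bigr => i _; case: ifP; rewrite ?add0r // addrC.
rewrite bigA_distr coef_sum -sum1_card natr_sum [RHS]big_mkcond.
apply: eq_bigr => S _; rewrite inE -big_mkcond /=.
have [/forall_inP SA|/forall_inPn[i Si /negPf nA]] :=
  boolP [forall i in S, A i.+1].
  have -> : \prod_(i in S) (if A i.+1 then 'X^(i.+1) else 0)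
      = 'X^(\sum_(i in S) i.+1) :> {poly int}.
    by rewrite -prodrXr; apply: eq_bigr => i /SA ->.
  by rewrite coefXn eq_sym; case: eqP.
by rewrite (bigD1 i) //= nA mul0r coef0.
Qed.

Definition part_set n B (s : box n) : {set 'I_B} :=
  [set i : 'I_B | i.+1 \in parts s].

Lemma mem_le_sumn (l : seq nat) x : x \in l -> (x <= sumn l)%N.
Proof. by move=> lx; rewrite (perm_sumn (perm_to_rem lx)) /= leq_addr. Qed.

Lemma perm_part_set n B A (s : box n) :
  distinct_in A (parts s) -> (sumn (parts s) <= B)%N ->
  perm_eq (parts s) [seq (val i).+1 | i <- enum (part_set B s)].
Proof.
move=> /and3P[/andP[_ /allP pos] us _] leB; apply: uniq_perm => //.
  by rewrite map_inj_uniq ?enum_uniq // => i j [] /val_inj.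
move=> x; apply/idP/mapP => [sx|[i]]; last by rewrite mem_enum inE => ? ->.
have ltB : (x.-1 < B)%N by have := mem_le_sumn sx; have := pos x sx; lia.
have def_x : x = x.-1.+1 by have := pos x sx; lia.
by exists (Ordinal ltB); rewrite // mem_enum inE /= -def_x.
Qed.

(** A partition into distinct parts is determined by its set of parts, and every
    set of parts with the right sum fits into the box. *)
Lemma card_distinct_boxes A n m B : (m <= n)%N -> (m <= B)%N ->
  #|distinct_boxes A n m| = #|weighted_sets A B m|.
Proof.
move=> le_mn le_mB.
have sumE (S : {set 'I_B}) :
    sumn [seq (val i).+1 | i <- enum S] = (\sum_(i in S) i.+1)%N.
  by rewrite sumnE big_map big_enum.
rewrite -(card_in_imset (f := @part_set n B)); last first.
  move=> s t; rewrite !inE => /andP[ds /eqP sum_s] /andP[dt /eqP sum_t] eq_st.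
  apply: parts_inj; apply: (sorted_eq (leT := geq)).
  - by move=> y x z /=; lia.
  - by move=> x y /=; lia.
  - by case/and3P: ds => /andP[].
  - by case/and3P: dt => /andP[].
  apply: (perm_trans (perm_part_set (B := B) ds _)); first by rewrite sum_s.
  by rewrite eq_st perm_sym; apply: (perm_part_set (B := B) dt); rewrite sum_t.
apply: eq_card => S; rewrite inE; apply/imsetP/andP => [[s]|[SA /eqP sumS]].
  rewrite inE => /andP[ds /eqP sum_s] ->; split.
    apply/forall_inP => i; rewrite inE => si.
    by case/and3P: ds => _ _ /allP/(_ _ si).
  rewrite -sumE -(perm_sumn (perm_part_set (B := B) ds _)) ?sum_s //.
pose l := sort geq [seq (val i).+1 | i <- enum S].
have sum_l : sumn l = m by rewrite (perm_sumn (permEl (perm_sort _ _))) sumE.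
have mem_l x : (x \in l) = (x \in [seq (val i).+1 | i <- enum S]).
  by rewrite mem_sort.
have part_l : is_partition l.
  apply/andP; split; first by apply: sort_sorted => x y /=; lia.
  by apply/allP => x; rewrite mem_l => /mapP[i _ ->].
have [s def_s] := @in_boxP n l part_l (leq_trans (eq_leq sum_l) le_mn).
exists s.
  rewrite inE def_s sum_l eqxx andbT /distinct_in part_l /= sort_uniq.
  rewrite map_inj_uniq ?enum_uniq => [|i j [] /val_inj //] /=.
  apply/allP => x; rewrite mem_l => /mapP[i]; rewrite mem_enum => Si ->.
  by move/forall_inP: SA; apply.
apply/setP => i; rewrite inE def_s mem_l.
apply/idP/mapP => [Si|[j]]; first by exists i; rewrite ?mem_enum.
by rewrite mem_enum => Sj [] /val_inj ->.
Qed.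

Lemma coef_distinct_gf A B n m : (m <= n)%N -> (m <= B)%N ->
  (distinct_gf ('X : {poly int}) A B)`_m = #|distinct_boxes A n m|%:R.
Proof.
move=> le_mn le_mB.
by rewrite coef_distinct_gf_sets (card_distinct_boxes _ le_mn le_mB).
Qed.

Lemma D5E n : D5 n = distinct_boxes (fun x => ~~ (5 %| x)%N) n n.
Proof. by apply/setP => s; rewrite !inE /distinct_in; do !bool_congr. Qed.

(** The coefficient of a product, by splitting the pairs according to the size
    of the first partition. *)
Lemma card_C a b n B : (n <= B)%N ->
  #|C a b n|%:R = (distinct_gf ('X : {poly int}) (avoids a b) B *
                   distinct_gf 'X (dvdn 5) B)`_n.
Proof.
move=> le_nB; rewrite coefM.
transitivity ((\sum_(j < n.+1) #|distinct_boxes (avoids a b) n j| *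
   #|distinct_boxes (dvdn 5) n (n - j)|)%N%:R : int); last first.
  rewrite natr_sum; apply: eq_bigr => j _; rewrite natrM.
  by rewrite !(@coef_distinct_gf _ B n) //; have := ltn_ord j; lia.
congr (_%:R); rewrite -sum1_card.
rewrite (partition_big (fun p : box n * box n =>
  inord (sumn (parts p.1)) : 'I_n.+1) predT) //=.
apply: eq_bigr => j _; rewrite sum1_card -cardsX; apply: eq_card => -[s t].
rewrite unfold_in !inE /distinct_in /=.
apply/andP/andP =>
  [[/and5P[-> -> /eqP sum_n -> /and3P[-> -> ->]] /eqP <-] | []].
  by rewrite inordK ?eqxx /=; last lia; split=> //; apply/eqP; lia.
move=> /andP[/and3P[-> -> ->] /eqP s_j] /andP[/and3P[-> -> ->] /eqP t_j].
rewrite s_j t_j /= inord_val eqxx andbT; split=> //.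
by have := ltn_ord j; lia.
Qed.

Lemma eq_qpolyXn_coef K (p1 p2 : {poly int}) : (0 < K)%N ->
  in_qpoly 'X^K p1 = in_qpoly 'X^K p2 -> forall i, (i < K)%N -> p1`_i = p2`_i.
Proof.
move=> K_gt0 /(congr1 val) /=.
rewrite mk_monic_Xn prednK // => eq_mod i ltiK.
have mod_coef (p : {poly int}) : p`_i = (Pdiv.CommonRing.rmodp p 'X^K)`_i.
  rewrite {1}(Pdiv.RingMonic.rdivp_eq (monicXn _ K) p) coefD coefMXn ltiK.
  by rewrite add0r.
by rewrite mod_coef eq_mod -mod_coef.
Qed.

Lemma qpolyXn_nil K : (0 < K)%N -> in_qpoly 'X^K ('X : {poly int}) ^+ K = 0.
Proof.
move=> K_gt0; rewrite -rmorphXn; apply: val_inj => /=.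
by rewrite mk_monic_Xn prednK // Pdiv.RingMonic.rmodpp // monicXn.
Qed.

Local Open Scope nat_scope.

Theorem theorem6p1 (n : nat) (n_ge1 : 1 <= n) :
  #|D5 n| = #|C 1 2 n| + #|C 3 4 (n - 1)|.
Proof.
(* A bound on the parts: at least [n], and a whole number of periods. *)
pose B := 10 * (n.+1 + n.+1).
have le_nB : n <= B by rewrite /B; lia.
apply/eqP; rewrite -(eqr_nat int) natrD D5E -(@coef_distinct_gf _ B) //.
rewrite !(@card_C _ _ _ B) //; last by lia.
pose M : {poly int} := distinct_gf 'X%R (dvdn 5) B.
pose rhs : {poly int} := (distinct_gf 'X (avoids 1 2) B * M
                          + 'X * (distinct_gf 'X (avoids 3 4) B * M))%R.
apply/eqP; transitivity (rhs`_n)%R; last first.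
  by rewrite coefD coefXM -subn1 eqn0Ngt n_ge1.
apply: (@eq_qpolyXn_coef n.+1) => //.
rewrite !(rmorphD, rmorphM) /= !rmorph_distinct_gf.
exact: distinct_gf_identity (qpolyXn_nil (ltn0Sn n)) (leqnn _).
Qed.
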